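(* Consider the Probabilistic Serial mechanism with $n$ agents and $m \le n$ items in the following dichotomous setting for agent 1. Agent 1 has a true strict linear order $\succ_1$ over the items; let $\overline{O}$ be the set of its $k$ most preferred items under $\succ_1$ (for some $1 \le k \le m$), and let agent 1's utility from an allocation be the total amount it receives of items in $\overline{O}$. Fix arbitrary reported strict linear orders of agents $2,\dots,n$. Let $u_1$ be agent 1's utility when it reports $\succ_1$, and let $T$ be the time at which the last item of $\overline{O}$ is exhausted in this truthful run. If $0 < T < \tfrac12$, then for every strict linear order $\succ'_1$ reported by agent 1, its resulting utility $u'_1$ satisfies $u'_1 \le \tfrac32 u_1$.
   Context: Probabilistic Serial: there are $n$ agents and $m$ divisible items of unit supply; each agent reports a strict linear order over all items. Starting at time $0$, every agent consumes at rate $1$ per unit time its most preferred item (according to its report) among those with positive remaining supply; when an item is exhausted, agents consuming it move to their most preferred item still available; this continues until all items are exhausted. Each agent's allocation is the amount of each item it consumed. (In the truthful run agent 1 eats only items of $\overline{O}$ until time $T$, so $u_1 = T$.) *)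

(* Defs.v *)
From HB Require Import structures.
From mathcomp Require Import all_boot all_order all_fingroup all_algebra.
Set Implicit Arguments. Unset Strict Implicit. Unset Printing Implicit Defensive.
Import Order.TTheory GRing.Theory Num.Theory.
Local Open Scope ring_scope.

Section PS.
Variable R : realFieldType.
Variables n m : nat.

(* A strict linear order over the items 'I_m is a permutation s : s 0 is the
   most preferred item, s 1 the second, ... *)
Definition profile := 'I_n -> {perm 'I_m}.

Definition top_item (s : {perm 'I_m}) (A : {set 'I_m}) : option 'I_m :=
  ohead [seq s k | k <- enum 'I_m & s k \in A].

Record ps_state := PSState {
  ps_time : R;
  ps_supply : 'I_m -> R;
  ps_avail : {set 'I_m};
  ps_alloc : 'I_n -> 'I_m -> R;
  ps_exh : 'I_m -> R }.           (* exhaustion time (meaningful once exhausted) *)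

Definition eaters (P : profile) (A : {set 'I_m}) (j : 'I_m) : nat :=
  #|[set i | top_item (P i) A == Some j]|.

(* One phase: everybody eats its top available item at rate 1 until the
   first moment some item(s) get exhausted. *)
Definition ps_step (P : profile) (st : ps_state) : ps_state :=
  let A := ps_avail st in
  let s := ps_supply st in
  let c := eaters P A in
  let L := [seq s j / (c j)%:R | j <- enum 'I_m & (j \in A) && (0 < c j)%N] in
  match L with
  | [::] => st
  | x :: L' =>
    let d := foldr Order.min x L' in
    let s' := fun j => s j - (c j)%:R * d in
    let A' := [set j in A | s' j != 0] in
    PSState (ps_time st + d) s' A'
      (fun i j => ps_alloc st i j + (if top_item (P i) A == Some j then d else 0))
      (fun j => if (j \in A) && (j \notin A') then ps_time st + d else ps_exh st j)
  end.

Definition ps_init : ps_state :=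
  PSState 0 (fun _ => 1) setT (fun _ _ => 0) (fun _ => 0).

(* each phase exhausts at least one item, so m phases finish the run *)
Definition ps_run (P : profile) : ps_state := iter m (ps_step P) ps_init.

Definition ps_allocation (P : profile) (i : 'I_n) (j : 'I_m) : R :=
  ps_alloc (ps_run P) i j.

Definition ps_exhaust_time (P : profile) (j : 'I_m) : R := ps_exh (ps_run P) j.

Definition upd (P : profile) (a : 'I_n) (s : {perm 'I_m}) : profile :=
  fun i => if i == a then s else P i.

End PS.

Definition top_set (m : nat) (s : {perm 'I_m}) (k : nat) : {set 'I_m} :=
  [set s j | j : 'I_m & (j < k)%N].

(* Main.v *)
Require Import Defs.
From HB Require Import structures.
From mathcomp Require Import all_boot all_order all_fingroup all_algebra.
From mathcomp Require Import lra.
Import Order.TTheory GRing.Theory Num.Theory.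
Local Open Scope ring_scope.

Set Implicit Arguments.
Unset Strict Implicit.
Unset Printing Implicit Defensive.

(** An agent starts eating an item [j] once all the items it prefers to [j] are
    exhausted, so a run is determined by the exhaustion times [X]: agent [i]
    gets [max (0, X j - M i j)] of [j], where [M i j] is the maximum of [X] over
    the items [i] prefers to [j], and these shares add up to [1].

    Compare both the truthful run and the manipulated run with the run without
    agent 1, in which every item lasts at least as long.  Truthfully, nothing of
    [O] is left at time [T]; up to [T] agent 1 eats exactly [T], so without it at
    most [T] of [O] is left, hence at most [T] is left in the manipulated run as
    well.  An item of [O] not exhausted at [T] in that run has lost at least
    [1 - T > T], so it already has an eater other than agent 1, and agent 1 gets
    at most half of what is left.  Its utility is thus at most [T + T / 2],
    whereas [u1 = T]. *)

(** * The most preferred available item *)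

Section TopItem.
Variable m : nat.
Implicit Types (s : {perm 'I_m}) (A : {set 'I_m}).

Variant top_item_spec s A : option 'I_m -> Prop :=
  | TopNone of A = set0 : top_item_spec s A None
  | TopSome (q : 'I_m) of s q \in A & (forall q', s q' \in A -> (q <= q')%N) :
      top_item_spec s A (Some (s q)).

Lemma top_itemP s A : top_item_spec s A (top_item s A).
Proof.
rewrite /top_item.
have memE q : (q \in [seq k <- enum 'I_m | s k \in A]) = (s q \in A).
  by rewrite mem_filter mem_enum andbT.
have srt : sorted ltn (map val [seq k <- enum 'I_m | s k \in A]).
  rewrite sorted_map; apply: sorted_filter; first by move=> ? ? ?; apply: ltn_trans.
  by have := iota_ltn_sorted 0 m; rewrite -val_enum_ord sorted_map.
case: [seq k <- enum 'I_m | s k \in A] memE srt => [|q r] memE srt /=.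
  constructor; apply/setP => j; rewrite inE -(permKV s j) -memE //.
constructor; first by rewrite -memE mem_head.
move=> q'; rewrite -memE inE => /orP[/eqP->//|rq'].
move: srt => /= /(order_path_min ltn_trans)/allP/(_ (val q')).
by rewrite map_f // => /(_ isT)/ltnW.
Qed.

Lemma top_item_None s A : (top_item s A == None) = (A == set0).
Proof.
case: top_itemP => [->|q qA _]; first by rewrite !eqxx.
by apply/esym/negbTE/set0Pn; exists (s q).
Qed.

Lemma top_item_Some s A j : top_item s A = Some j <->
  j \in A /\ forall q : 'I_m, (q < (s^-1)%g j)%N -> s q \notin A.
Proof.
case: top_itemP => [->|q qA qmin].
  by split=> // -[]; rewrite inE.
split=> [[<-]|[jA jmin]].
  split=> // q'; rewrite permK ltnNge; apply: contra; exact: qmin.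
congr Some; rewrite -[j](permKV s); congr (s _); apply/val_inj/eqP => /=.
rewrite eqn_leq qmin ?permKV //= leqNgt.
by apply/negP => /jmin; rewrite qA.
Qed.

End TopItem.

(** * Shares as functions of the exhaustion times *)

Section Shares.
Variables (R : realFieldType) (m : nat).
Implicit Types (s : {perm 'I_m}) (X : 'I_m -> R).

(** With exhaustion times [X], this is the moment when an agent with order [s] has run out of its
    [r] best items; the default 0 is the start of the run. *)
Definition prefix_max s X (r : nat) : R :=
  \big[Num.max/0]_(q < m | (q < r)%N) X (s q).

(* The amount of [j] eaten up to time [x] by an agent that starts on [j] as
   soon as all the items it prefers to [j] are exhausted. *)
Definition share s X (x : R) j : R :=
  Num.max 0 (x - prefix_max s X ((s^-1)%g j)).

Lemma prefix_max_ge0 s X r : 0 <= prefix_max s X r.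
Proof. exact: bigmax_ge_id. Qed.

Lemma prefix_max0 s X : prefix_max s X 0 = 0.
Proof. by rewrite /prefix_max big_pred0. Qed.

Lemma le_prefix_max s X Y r : (forall q : 'I_m, (q < r)%N -> X (s q) <= Y (s q)) ->
  prefix_max s X r <= prefix_max s Y r.
Proof.
move=> XY; apply: bigmax_le => [|q qr]; first exact: prefix_max_ge0.
by apply: le_trans (XY q qr) _; apply: (le_bigmax_cond _ (fun q : 'I_m => Y (s q))).
Qed.

Lemma prefix_max_ge s X r (q : 'I_m) : (q < r)%N -> X (s q) <= prefix_max s X r.
Proof. by move=> qr; apply: (le_bigmax_cond _ (fun q : 'I_m => X (s q))). Qed.

Lemma prefix_maxS s X (q : 'I_m) :
  prefix_max s X q.+1 = Num.max (prefix_max s X q) (X (s q)).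
Proof.
apply/le_anti/andP; split.
  apply: bigmax_le => [|q']; first by rewrite le_max prefix_max_ge0.
  rewrite ltnS leq_eqVlt le_max => /orP[/eqP/val_inj->|q'q]; first by rewrite lexx orbT.
  by rewrite prefix_max_ge.
rewrite ge_max prefix_max_ge // andbT.
by apply: bigmax_le => [|q' q'q]; rewrite ?prefix_max_ge0 // prefix_max_ge // ltnS ltnW.
Qed.

Lemma share_ge0 s X x j : 0 <= share s X x j.
Proof. by rewrite le_max lexx. Qed.

Lemma le_share s X Y x y j : x <= y ->
  (forall q : 'I_m, (q < (s^-1)%g j)%N -> Y (s q) <= X (s q)) ->
  share s X x j <= share s Y y j.
Proof.
move=> xy YX; rewrite ge_max share_ge0 /= /share le_max; apply/orP; right.
by apply: lerB => //; apply: le_prefix_max.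
Qed.

(* The pieces eaten before time [t] cover [0, t] without overlap. *)
Lemma sum_share s X t r : 0 <= t -> (r <= m)%N ->
  \sum_(q < m | (q < r)%N) share s X (Num.min (X (s q)) t) (s q)
  = Num.min (prefix_max s X r) t.
Proof.
move=> t0; elim: r => [|r IHr] rm.
  by rewrite prefix_max0 big_pred0 // min_l.
rewrite (bigD1 (Ordinal rm)) //= (eq_bigl (fun q : 'I_m => (q < r)%N)); last first.
  by move=> q; rewrite -val_eqE /= ltnS [in RHS]ltn_neqAle andbC.
rewrite IHr 1?ltnW // (prefix_maxS s X (Ordinal rm)) /share permK /=.
set M := prefix_max _ _ _; set x := X _.
by case: (leP M x) => Mx; case: (leP x t) => xt; case: (leP M t) => Mt;
  case: (leP 0 (_ - M)) => ?; lra.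
Qed.

(** Cutting the pieces at time [prefix_max s X k] removes nothing, so [sum_share] applies. This
    evaluates the truthful utility. *)
Lemma sum_share_top s X k : (k <= m)%N ->
  \sum_(j in top_set s k) share s X (X j) j = prefix_max s X k.
Proof.
move=> km; rewrite big_imset /=; last by move=> ? ? _ _; apply: perm_inj.
have := @sum_share s X (prefix_max s X k) k (prefix_max_ge0 _ _ _) km.
rewrite minxx => <-; under eq_bigl do rewrite inE.
by apply: eq_bigr => q qk; rewrite min_l // prefix_max_ge.
Qed.

Lemma sum_share_all s X t : 0 <= t ->
  \sum_j share s X (Num.min (X j) t) j = Num.min (prefix_max s X m) t.
Proof.
move=> t0; rewrite (reindex_inj (@perm_inj _ s)) -sum_share //.
by apply: eq_bigl => q; rewrite ltn_ord.
Qed.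

Lemma prefix_max_full_ge s X j : X j <= prefix_max s X m.
Proof. by rewrite -[j](permKV s) prefix_max_ge. Qed.

End Shares.

(** * Invariant of the phase-by-phase run *)

Section Run.
Variables (R : realFieldType) (n m : nat) (P : profile n m).
Implicit Types (st : ps_state R n m).

(* Exhaustion times as seen in state [st]: items still available count as
   exhausted right now. *)
Definition clock st j : R :=
  if j \in ps_avail st then ps_time st else ps_exh st j.

(** Once no item is available, [inv_supply], [inv_exhausted] and [inv_alloc] together become the
    equations for the exhaustion times. *)
Record ps_inv st : Prop := PSInv {
  inv_clock : forall j, 0 <= clock st j <= ps_time st;
  inv_supply : forall j, ps_supply st j = 1 - \sum_i ps_alloc st i j;
  inv_avail : forall j, j \in ps_avail st -> 0 < ps_supply st j;
  inv_exhausted : forall j, j \notin ps_avail st -> ps_supply st j = 0;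
  inv_alloc : forall i j,
    ps_alloc st i j = share (P i) (clock st) (clock st j) j }.

Lemma ps_inv_init : ps_inv (ps_init R n m).
Proof.
have clock0 j : clock (ps_init R n m) j = 0 by rewrite /clock /= inE.
split=> [j|j|j _|j|i j]; rewrite ?clock0 /= ?lexx ?ltr01 ?inE //.
  by rewrite big1 ?subr0.
by rewrite /share max_l // sub0r oppr_le0 prefix_max_ge0.
Qed.

Lemma foldr_min_mem (x : R) L : foldr Order.min x L \in x :: L.
Proof.
elim: L => [|y L IHL] /=; first exact: mem_head.
case: leP => _; first by rewrite !inE eqxx orbT.
by move: IHL; rewrite !inE => /orP[->|->]; rewrite ?orbT.
Qed.

Lemma foldr_min_le (x : R) L y : y \in x :: L -> foldr Order.min x L <= y.
Proof.
elim: L => [|z L IHL] /=; first by rewrite inE => /eqP->.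
rewrite !inE orbCA ge_min => /orP[/eqP->|yxL]; first by rewrite lexx.
by rewrite IHL ?orbT // inE.
Qed.

(** The nonempty branch of [ps_step], with the length of the phase abstracted. *)
Definition phase d st : ps_state R n m :=
  let A := ps_avail st in
  let s' := fun j => ps_supply st j - (eaters P A j)%:R * d in
  let A' := [set j in A | s' j != 0] in
  PSState (ps_time st + d) s' A'
    (fun i j => ps_alloc st i j + (if top_item (P i) A == Some j then d else 0))
    (fun j => if (j \in A) && (j \notin A') then ps_time st + d else ps_exh st j).

Lemma eaters_gt0 A j : (0 < eaters P A j)%N -> j \in A.
Proof.
by rewrite card_gt0 => /set0Pn[i]; rewrite inE => /eqP/top_item_Some[].
Qed.

Variant ps_step_spec st : ps_state R n m -> Prop :=
  | StepDone of (forall j, eaters P (ps_avail st) j = 0%N) : ps_step_spec st st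
  | StepPhase d j of 0 <= d & j \in ps_avail st
      & ps_supply st j = (eaters P (ps_avail st) j)%:R * d
      & (forall l, (eaters P (ps_avail st) l)%:R * d <= ps_supply st l) :
      ps_step_spec st (phase d st).

Lemma ps_stepP st : ps_inv st -> ps_step_spec st (ps_step P st).
Proof.
move=> inv; rewrite /ps_step.
set L := map _ _.
have memL y : reflect (exists2 j, (0 < eaters P (ps_avail st) j)%N &
    y = ps_supply st j / (eaters P (ps_avail st) j)%:R) (y \in L).
  apply: (iffP mapP) => [[j]|[j cj ->]].
    by rewrite mem_filter => /andP[/andP[_ cj] _] ->; exists j.
  by exists j => //; rewrite mem_filter mem_enum cj eaters_gt0.
have s0 l : 0 <= ps_supply st l.
  have [/(inv_avail inv)/ltW//|/(inv_exhausted inv)->//] := boolP (l \in ps_avail st).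
case: L memL => [|x L] memL.
  constructor=> j; apply/eqP; rewrite -leqn0 leqNgt; apply/negP => cj.
  suff /memL: exists2 l, (0 < eaters P (ps_avail st) l)%N &
    ps_supply st j / (eaters P (ps_avail st) j)%:R
    = ps_supply st l / (eaters P (ps_avail st) l)%:R by rewrite in_nil.
  by exists j.
have /memL[j cj dE] := foldr_min_mem x L.
have cj0 : (eaters P (ps_avail st) j)%:R != 0 :> R by rewrite pnatr_eq0 -lt0n.
apply: (@StepPhase _ (foldr Order.min x L) j); rewrite ?eaters_gt0 //.
- by rewrite dE divr_ge0.
- by rewrite dE mulrC divfK.
move=> l; have [->|cl] := posnP (eaters P (ps_avail st) l); first by rewrite mul0r.
rewrite mulrC -ler_pdivlMr ?ltr0n //; apply: foldr_min_le; apply/memL.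
by exists l.
Qed.

Lemma clock_phase d st j :
  clock (phase d st) j = if j \in ps_avail st then ps_time st + d else clock st j.
Proof.
rewrite /clock /= !inE; case: (j \in ps_avail st) => //=.
by case: (_ != 0).
Qed.

(** If an item preferred to [j] is still available, its clock is the current time and the share of
    [j] is 0 before and after. Otherwise the starting time on [j] is frozen, and only the clock of
    [j] can move. *)
Lemma share_phase (d : R) st i j : 0 <= d -> ps_inv st ->
  share (P i) (clock (phase d st)) (clock (phase d st) j) j =
  share (P i) (clock st) (clock st j) j
  + (if top_item (P i) (ps_avail st) == Some j then d else 0).
Proof.
move=> d0 inv; set s := P i; set A := ps_avail st; set r := (s^-1)%g j : nat.
have clockA l : l \in A -> clock st l = ps_time st by rewrite /clock => ->.
have [/existsP[q /andP[qr qA]]|noA] := boolP [exists q : 'I_m, (q < r)%N && (s q \in A)].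
  have -> : (top_item s A == Some j) = false.
    by apply/negP => /eqP/top_item_Some[_ /(_ q qr)]; rewrite qA.
  have le0 x Y : x <= Y (s q) -> share s Y x j = 0.
    by move=> xY; apply/max_l; rewrite subr_le0 (le_trans xY) // prefix_max_ge.
  have /andP[_ jt] := inv_clock inv j.
  have -> : share s (clock st) (clock st j) j = 0 by rewrite le0 // (clockA (s q)).
  rewrite addr0 le0 // !clock_phase qA; case: ifP => // _.
  by rewrite ler_wpDr.
have noA' (q : 'I_m) : (q < r)%N -> s q \notin A.
  by move=> qr; apply: contra noA => qA; apply/existsP; exists q; rewrite qr.
have eqM : prefix_max s (clock (phase d st)) r = prefix_max s (clock st) r.
  by apply: eq_bigr => q /noA' qA; rewrite clock_phase (negbTE qA).
rewrite /share -/r eqM clock_phase -/A.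
have [jA|jA] := boolP (j \in A); last first.
  rewrite (_ : _ == _ = false) ?addr0 //.
  by apply/negP => /eqP/top_item_Some[]; rewrite (negbTE jA).
have -> : top_item s A == Some j by apply/eqP/top_item_Some; split.
rewrite clockA //.
have Mt : prefix_max s (clock st) r <= ps_time st.
  apply: bigmax_le => [|q _]; last by case/andP: (inv_clock inv (s q)).
  by case/andP: (inv_clock inv j) => /le_trans; apply.
by rewrite !max_r ?subr_ge0 //; lra.
Qed.

Lemma ps_inv_phase (d : R) st : 0 <= d -> ps_inv st ->
  (forall l, (eaters P (ps_avail st) l)%:R * d <= ps_supply st l) ->
  ps_inv (phase d st).
Proof.
move=> d0 inv cds; split=> [j|j|j|j|i j].
- have /andP[h1 h2] := inv_clock inv j.
  rewrite clock_phase /=; case: ifP => _; apply/andP; split; lra.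
- rewrite /= big_split /= (inv_supply inv) -big_mkcond /= sumr_const.
  rewrite opprD addrA mulr_natl; congr (_ - _ *+ _).
  by apply: eq_card => i; rewrite !inE.
- by rewrite /= inE => /andP[_ s0]; rewrite lt_neqAle eq_sym s0 subr_ge0 cds.
- rewrite /= inE negb_and negbK => /orP[jA|/eqP//].
  rewrite (inv_exhausted inv) // (_ : eaters _ _ _ = 0%N) ?mul0r ?subr0 //.
  by apply/eqP; rewrite -leqn0 leqNgt; apply: contra jA => /eaters_gt0.
- by rewrite share_phase // -(inv_alloc inv).
Qed.

Lemma ps_inv_step st : ps_inv st -> ps_inv (ps_step P st).
Proof. by move=> inv; case: (ps_stepP inv) => // d j *; apply: ps_inv_phase. Qed.

Lemma card_avail_step st : (0 < n)%N -> ps_inv st ->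
  (#|ps_avail (ps_step P st)| <= #|ps_avail st|.-1)%N.
Proof.
(* With at least one agent, nobody eats only if nothing is available; otherwise the item [j] that
   determines [d] runs out. *)
move=> n0 inv; case: (ps_stepP inv) => [c0|d j d0 jA sj _].
  case E: (top_item (P (Ordinal n0)) (ps_avail st)) => [j|]; last first.
    by move/eqP: E; rewrite top_item_None => /eqP->; rewrite cards0.
  have : (0 < eaters P (ps_avail st) j)%N.
    by rewrite card_gt0; apply/set0Pn; exists (Ordinal n0); rewrite inE E.
  by rewrite c0.
rewrite (cardsD1 j (ps_avail st)) jA /=; apply/subset_leq_card/subsetP => l.
rewrite !inE => /andP[-> nz]; rewrite andbT; apply: contra nz => /eqP->.
by rewrite sj subrr.
Qed.

Lemma ps_inv_iter p : ps_inv (iter p (ps_step P) (ps_init R n m)).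
Proof. by elim: p => [|p] /=; [exact: ps_inv_init|exact: ps_inv_step]. Qed.

Lemma ps_avail_run : (0 < n)%N -> ps_avail (ps_run R P) = set0.
Proof.
move=> n0; apply/eqP; rewrite -cards_eq0 -leqn0.
suff H p : (#|ps_avail (iter p (ps_step P) (ps_init R n m))| <= m - p)%N.
  by rewrite (leq_trans (H m)) ?subnn.
elim: p => [|p IHp] /=; first by rewrite subn0 cardsT card_ord.
apply: leq_trans (card_avail_step n0 (ps_inv_iter p)) _.
by rewrite subnS -!subn1 leq_sub2r.
Qed.

End Run.

(** * Equations for the exhaustion times *)

Section EatingTimes.
Variables (R : realFieldType).

(* [X] solves the equations that determine the exhaustion times: each unit of
   supply is split into the shares that the agents eat of it. *)
Definition eating_times n m (P : profile n m) (X : 'I_m -> R) : Prop :=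
  forall j, \sum_i share (P i) X (X j) j = 1.

Lemma clock_run n m (P : profile n m) j : (0 < n)%N ->
  clock (ps_run R P) j = ps_exhaust_time R P j.
Proof. by move=> n0; rewrite /clock ps_avail_run // inE. Qed.

Lemma ps_allocationE n m (P : profile n m) i j : (0 < n)%N ->
  ps_allocation R P i j =
  share (P i) (ps_exhaust_time R P) (ps_exhaust_time R P j) j.
Proof.
move=> n0; rewrite /ps_allocation (inv_alloc (ps_inv_iter R P m)) clock_run //.
by congr Num.max; congr (_ - _); apply: eq_bigr => q _; rewrite clock_run.
Qed.

Lemma eating_times_run n m (P : profile n m) : (0 < n)%N ->
  eating_times P (ps_exhaust_time R P).
Proof.
move=> n0 j; under eq_bigr do rewrite -ps_allocationE //.
have := inv_supply (ps_inv_iter R P m) j.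
rewrite (inv_exhausted (ps_inv_iter R P m)) ?ps_avail_run ?inE //.
by move/esym/eqP; rewrite subr_eq0 => /eqP.
Qed.

Lemma eating_times_ge0 n m (P : profile n m) X j : eating_times P X -> 0 <= X j.
Proof.
move=> /(_ j) sumX; rewrite leNgt; apply/negP => Xj0.
suff: \sum_i share (P i) X (X j) j = 0 by rewrite sumX => /eqP; rewrite oner_eq0.
apply: big1 => i _; apply: max_l.
by rewrite subr_le0 (le_trans (ltW Xj0)) ?prefix_max_ge0.
Qed.

(** * Removing one agent *)

Definition drop_agent n m (P : profile n.+1 m) (a : 'I_n.+1) : profile n m :=
  fun i => P (lift a i).

(* Look at an item exhausted too early in the smaller run, as early as possible:
   every agent reaches it at least as early in the larger run. *)
Lemma exhaust_drop_agent n m (P : profile n.+1 m) a X Y :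
  eating_times P X -> eating_times (drop_agent P a) Y -> forall j, X j <= Y j.
Proof.
move=> eX eY j0; rewrite leNgt; apply/negP => viol0.
case: (@arg_minP _ _ _ j0 (fun j => Y j < X j) Y viol0) => j viol jmin.
(* The equality case matters: both totals are 1, so equality is forced for all remaining agents, and
   then all their shares vanish. *)
have le_ag i : share (P i) Y (Y j) j <= share (P i) X (X j) j
    ?= iff (share (P i) Y (Y j) j == 0) && (share (P i) X (X j) j == 0).
  set M := share _ X _ _.
  have [Yj|Yj] := leP (Y j) (prefix_max (P i) Y ((P i)^-1%g j)).
    have E : share (P i) Y (Y j) j = 0 by apply: max_l; rewrite subr_le0.
    by rewrite E; split; rewrite ?share_ge0 ?eqxx // [LHS]eq_sym.
  (* Items preferred to [j] have [Y] below [Y j], so by minimality of [j] they satisfy [X <= Y]. *)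
  have MM : prefix_max (P i) X ((P i)^-1%g j) <= prefix_max (P i) Y ((P i)^-1%g j).
    apply: le_prefix_max => q qj; rewrite leNgt; apply/negP => /jmin.
    by rewrite leNgt (le_lt_trans _ Yj) // prefix_max_ge.
  have YE : share (P i) Y (Y j) j = Y j - prefix_max (P i) Y ((P i)^-1%g j).
    by apply: max_r; rewrite subr_ge0 ltW.
  have XE : M = X j - prefix_max (P i) X ((P i)^-1%g j).
    by apply: max_r; lra.
  have [lt1 lt2] : share (P i) Y (Y j) j < M /\ 0 < share (P i) Y (Y j) j.
    by rewrite YE XE; split; lra.
  by split; rewrite ?ltW ?(gt_eqF lt2) ?(lt_eqF lt1).
have := eX j; rewrite (bigD1_ord a) //= => sX.
have sY := eY j.
have := leif_sum (P := predT) (fun i (_ : predT i) => le_ag (lift a i)).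
rewrite /= -[\sum_(i < n) share _ Y _ _]/(\sum_i share (drop_agent P a i) Y (Y j) j) sY.
have X0 := share_ge0 (P a) X (X j) j.
case=> le1; have -> : 1 == \sum_(i < n) share (P (lift a i)) X (X j) j.
  by rewrite eq_le le1; lra.
move/esym/forallP => all0; move: sY; rewrite big1 => [/esym/eqP|i _].
  by rewrite oner_eq0.
by have /andP[/eqP] := all0 i.
Qed.

(** * Consumption up to a fixed time *)

Definition eaten n m (P : profile n m) (X : 'I_m -> R) t j : R :=
  \sum_i share (P i) X (Num.min (X j) t) j.

Lemma eaten_le1 n m (P : profile n m) X t j : eating_times P X -> eaten P X t j <= 1.
Proof.
move=> /(_ j) <-; apply: ler_sum => i _; apply: le_share => //.
by rewrite ge_min lexx.
Qed.

Lemma eaten_exhausted n m (P : profile n m) X t j : eating_times P X ->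
  X j <= t -> eaten P X t j = 1.
Proof. by move=> eX Xt; rewrite /eaten min_l. Qed.

(** Either [j] is already gone in the larger run, or there every remaining agent reaches [j] no
    later and can eat it until [t]. *)
Lemma eaten_drop_agent n m (P : profile n.+1 m) a X Y t j :
  eating_times P X -> eating_times (drop_agent P a) Y ->
  eaten (drop_agent P a) Y t j <= eaten P X t j.
Proof.
move=> eX eY; have XY := exhaust_drop_agent eX eY.
have [Xt|Xt] := leP (X j) t; first by rewrite (eaten_exhausted eX Xt) eaten_le1.
rewrite [leRHS]/eaten (bigD1_ord a) //= ler_wpDl ?share_ge0 //.
apply: ler_sum => i _; apply: le_share => //.
by rewrite [leRHS]min_r ?ge_min ?lexx ?orbT // ltW.
Qed.

(** Item [l] lasts until [t], so no agent is idle before [t]. *)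
Lemma sum_eaten n m (P : profile n m) X t l : 0 <= t -> t <= X l ->
  \sum_j eaten P X t j = t *+ n.
Proof.
move=> t0 tX; rewrite exchange_big /= -[in RHS](card_ord n) -sumr_const.
apply: eq_bigr => i _; rewrite sum_share_all // min_r //.
exact: le_trans tX (prefix_max_full_ge _ _ _).
Qed.

(* Dropping the agent [a] reduces the total consumption up to time [t] by
   exactly [t], and no item gains from it. *)
Lemma remaining_drop_agent n m (P : profile n.+1 m) a X Y t l (O : {set 'I_m}) :
  eating_times P X -> eating_times (drop_agent P a) Y ->
  0 <= t -> t <= X l -> (forall j, j \in O -> X j <= t) ->
  \sum_(j in O) (1 - eaten (drop_agent P a) Y t j) <= t.
Proof.
move=> eX eY t0 tX XO.
have tY : t <= Y l by apply: le_trans tX (exhaust_drop_agent eX eY l).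
have sumE : \sum_j (eaten P X t j - eaten (drop_agent P a) Y t j) = t.
  by rewrite sumrB (sum_eaten _ t0 tX) (sum_eaten _ t0 tY) mulrS addrK.
rewrite -[leRHS]sumE [leRHS](bigID (fun j => j \in O)) /= ler_wpDr //.
  by apply: sumr_ge0 => j _; rewrite subr_ge0 eaten_drop_agent.
by apply: ler_sum => j /XO Xt; rewrite (eaten_exhausted eX Xt).
Qed.

(* An item with less than half of its supply left at time [t < 1/2] is already
   shared, so [a] gets at most half of what is left. *)
Lemma share_le_half n m (P : profile n.+1 m) a X t j :
  eating_times P X -> 0 <= t -> t < 1 / 2 -> 1 - eaten P X t j <= t ->
  share (P a) X (X j) j
    <= share (P a) X (Num.min (X j) t) j + (1 - eaten P X t j) / 2.
Proof.
move=> eX t0 t12 rem; have [Xt|Xt] := leP (X j) t.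
  by rewrite (eaten_exhausted eX Xt); lra.
(* Otherwise only [a] has eaten from [j], hence at most [t], whereas at least [1 - t > t] is
   gone. *)
have [i Mi] : exists i, prefix_max (P (lift a i)) X ((P (lift a i))^-1%g j) < t.
  apply/existsP; apply: contraT => /existsPn noi.
  have : eaten P X t j <= t; last by lra.
  rewrite /eaten (bigD1_ord a) //= (min_r (ltW Xt)) big1 ?addr0 => [|i _].
    by rewrite /share ge_max t0 /= gerBl prefix_max_ge0.
  by apply: max_l; rewrite subr_le0 leNgt.
pose gain i := share (P i) X (X j) j - share (P i) X t j.
have gain0 i' : 0 <= gain i' by rewrite subr_ge0 le_share // ltW.
have remE : 1 - eaten P X t j = \sum_i gain i.
  by rewrite sumrB eX /eaten min_r // ltW.
(* This agent eats [j] during all of [t, X j], so [a] cannot gain more than it does. *)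
have gaini : gain (lift a i) = X j - t.
  by rewrite /gain /share !max_r; lra.
have gaina : gain a <= X j - t.
  rewrite /gain /share; set M := prefix_max _ _ _.
  by case: (leP 0 (X j - M)) => ?; case: (leP 0 (t - M)) => ?; lra.
rewrite remE (bigD1_ord a) //= (bigD1 i) //= gaini.
have : 0 <= \sum_(i' < n | i' != i) gain (lift a i') by apply: sumr_ge0.
by move: gaina; rewrite /gain; lra.
Qed.

Lemma manipulation_bound n m (P P' : profile n.+1 m) a X X' Y t l (O : {set 'I_m}) :
  drop_agent P a =1 drop_agent P' a ->
  eating_times P X -> eating_times P' X' -> eating_times (drop_agent P a) Y ->
  0 <= t -> t < 1 / 2 -> t <= X l -> (forall j, j \in O -> X j <= t) ->
  \sum_(j in O) share (P' a) X' (X' j) j <= 3 / 2 * t.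
Proof.
move=> PP' eX eX' eY t0 t12 tX XO.
have eY' : eating_times (drop_agent P' a) Y.
  by move=> j; rewrite -[RHS](eY j); apply: eq_bigr => i _; rewrite PP'.
have rem : \sum_(j in O) (1 - eaten P' X' t j) <= t.
  apply: le_trans (remaining_drop_agent eX eY t0 tX XO).
  apply: ler_sum => j _; rewrite lerB // (_ : eaten _ Y t j = eaten (drop_agent P' a) Y t j).
    exact: eaten_drop_agent.
  by apply: eq_bigr => i _; rewrite PP'.
have rem0 j : 0 <= 1 - eaten P' X' t j by rewrite subr_ge0 eaten_le1.
have early : \sum_(j in O) share (P' a) X' (Num.min (X' j) t) j <= t.
  apply: (@le_trans _ _ (\sum_j share (P' a) X' (Num.min (X' j) t) j)).
    by rewrite [leRHS](bigID (fun j => j \in O)) /= lerDl sumr_ge0 // => *; apply: share_ge0.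
  by rewrite sum_share_all // ge_min lexx orbT.
suff : \sum_(j in O) share (P' a) X' (X' j) j <=
    \sum_(j in O) (share (P' a) X' (Num.min (X' j) t) j + (1 - eaten P' X' t j) / 2).
  by rewrite big_split /= -mulr_suml; lra.
apply: ler_sum => j jO; apply: share_le_half => //.
(* What is left of a single item is at most what is left of all of [O]. *)
apply: le_trans rem; rewrite (bigD1 j) //= lerDl.
exact: sumr_ge0.
Qed.

End EatingTimes.

Theorem theorem1 (R : realFieldType) (n m : nat) (hn : (0 < n)%N) (hmn : (m <= n)%N)
  (k : nat) (hk1 : (1 <= k)%N) (hkm : (k <= m)%N)
  (truth : {perm 'I_m}) (others : 'I_n -> {perm 'I_m}) :
  let a1 : 'I_n := Ordinal hn in
  let O := top_set truth k in
  let P := upd others a1 truth in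
  let u1 := \sum_(j in O) ps_allocation R P a1 j in
  let T := \big[Order.max/0]_(j in O) ps_exhaust_time R P j in
  0 < T -> T < 1 / 2 ->
  forall rep : {perm 'I_m},
    \sum_(j in O) ps_allocation R (upd others a1 rep) a1 j <= 3 / 2 * u1.
Proof.
case: n hn hmn others => // n hn hmn others a1 O P u1 T T0 T12 rep.
set X := ps_exhaust_time R P.
have eX : eating_times P X by apply: eating_times_run.
have XT j : j \in O -> X j <= T by apply: le_bigmax_cond.
have TM : T <= prefix_max truth X k.
  apply: bigmax_le => [|j /imsetP[q qk ->]]; first exact: prefix_max_ge0.
  by apply: prefix_max_ge; rewrite inE in qk.
have u1E : u1 = prefix_max truth X k.
  rewrite -sum_share_top //; apply: eq_bigr => j _.
  by rewrite ps_allocationE // /P /upd eqxx.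
have [l lO TX] : exists2 l, l \in O & T <= X l.
  have jO : truth (Ordinal (leq_trans hk1 hkm)) \in O by apply: imset_f; rewrite inE.
  case: (@arg_maxP _ _ _ _ (fun j => j \in O) X jO) => l lO lmax.
  by exists l => //; apply: bigmax_le => //; apply: eating_times_ge0 eX.
(* A lone agent needs time at least 1 to exhaust any item, contradicting [T < 1 / 2]. So the run
   without agent 1 has an agent and provides [Y]. *)
have n0 : (0 < n)%N.
  rewrite lt0n; apply/eqP => n_eq0; have := XT l lO.
  suff : 1 <= X l by lra.
  rewrite -(eX l) (bigD1 a1) //= big1 ?addr0 => [|i /negP[]].
    by rewrite /share ge_max (eating_times_ge0 l eX) gerBl prefix_max_ge0.
  apply/eqP/val_inj/eqP; rewrite /= -leqn0.
  by have := ltn_ord i; rewrite ltnS => /leq_trans; apply; rewrite n_eq0.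
apply: (@le_trans _ _ (3 / 2 * T)); last by rewrite u1E ler_wpM2l //; lra.
have eX' : eating_times (upd others a1 rep) (ps_exhaust_time R (upd others a1 rep)).
  exact: eating_times_run.
have eY := eating_times_run R (drop_agent P a1) n0.
under eq_bigr do rewrite ps_allocationE //.
apply: (manipulation_bound _ eX eX' eY (ltW T0) T12 TX XT) => i.
by rewrite /drop_agent /P /upd eq_sym (negbTE (neq_lift _ _)).
Qed.
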